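(* Let $k$ be a field of characteristic zero, let $(R,\Delta)$ be a commutative differential $k$-algebra, and let $H=(k^\times)^r$ be an algebraic torus acting rationally on $(R,\Delta)$. Assume that $R$ is affine over $k$, and that it has only finitely many prime $(H,\Delta)$-ideals. Then the rule $\pi_m(Q)=(Q:\Delta)$ defines a continuous surjection $$\pi_m:\max R\rightarrow\Delta\text{-}\operatorname{prim}R,$$ and $\Delta\text{-}\operatorname{prim}R$ is a topological quotient of $\max R$ via $\pi_m$.
   Context: Algebras are associative and unital. Affine means finitely generated as a $k$-algebra. A commutative differential $k$-algebra is a pair $(R,\Delta)$ with $R$ a commutative $k$-algebra and $\Delta$ a set of $k$-linear derivations on $R$. A $\Delta$-ideal is an ideal $I$ with $\delta(I)\subseteq I$ for all $\delta\in\Delta$. The $\Delta$-core $(J:\Delta)$ of an ideal $J$ is the largest $\Delta$-ideal contained in $J$. A $\Delta$-primitive ideal is an ideal of the form $(M:\Delta)$ with $M$ a maximal ideal of $R$. $\max R$ and $\Delta\text{-}\operatorname{prim}R$ denote the sets of maximal and $\Delta$-primitive ideals of $R$; each of these sets $X$ has the Zariski topology, with closed sets $\{P\in X\mid P\supseteq I\}$ for ideals $I$ of $R$. A space $Y$ is a topological quotient of $X$ via a surjection $\pi:X\to Y$ if the closed subsets of $Y$ are exactly the subsets $W$ with $\pi^{-1}(W)$ closed in $X$. An algebraic torus over $k$ is a group $H=(k^\times)^r$, $r\ge 0$; a rational character of $H$ is a group homomorphism $H\to k^\times$ that is also a morphism of algebraic varieties. When $H$ acts linearly on a $k$-vector space,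 an $H$-eigenvector is a nonzero $v$ with $h(v)\in kv$ for all $h\in H$; its $H$-eigenvalue is the character $f$ with $h(v)=f(h)v$ for all $h$. An action of $H$ on $R$ by $k$-algebra automorphisms is rational if $R$ is the direct sum of its $H$-eigenspaces and all corresponding $H$-eigenvalues are rational characters. $H$ acts on $\operatorname{Der}_k(R)$ by $h.\delta=h\circ\delta\circ h^{-1}$. $H$ acts rationally on $(R,\Delta)$ if (1) $H$ acts rationally on $R$ by $k$-algebra automorphisms; (2) $\Delta$ is a linear subspace of $\operatorname{Der}_k(R)$ stable under the induced $H$-action; (3) $\Delta$ is the direct sum of its $H$-eigenspaces, and the corresponding $H$-eigenvalues are all rational. A prime $(H,\Delta)$-ideal is a prime ideal stable under both $H$ and $\Delta$. *)

(* Defs.v *)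
From HB Require Import structures.
From mathcomp Require Import all_boot all_algebra.
From mathcomp Require Import all_classical topology zify.

Set Implicit Arguments.
Unset Strict Implicit.
Unset Printing Implicit Defensive.

Import GRing.Theory.
Local Open Scope classical_set_scope.
Local Open Scope ring_scope.

Section Ideals.
Variable R : comNzRingType.
Implicit Types I J P M : set R.

(* The unit ideal is allowed (the library's [idealr_closed] is about proper
   ideals only). *)
Definition ideal I : Prop :=
  [/\ I 0, forall x y, I x -> I y -> I (x + y) &
      forall a x, I x -> I (a * x)].

Definition prime_ideal P : Prop :=
  [/\ ideal P, ~ P 1 & forall x y, P (x * y) -> P x \/ P y].

Definition maximal_ideal M : Prop :=
  [/\ ideal M, ~ M 1 &
      forall I, ideal I -> M `<=` I -> ~ I 1 -> I = M].

Lemma idealT : ideal setT. Proof. by []. Qed.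

Lemma idealN I x : ideal I -> I x -> I (- x).
Proof. by case=> _ _ IM Ix; rewrite -mulN1r; exact: IM. Qed.

Lemma idealB I x y : ideal I -> I x -> I y -> I (x - y).
Proof. by move=> iI Ix Iy; have [_ ID _] := iI; apply: ID; rewrite //; exact: idealN. Qed.

Lemma idealI I J : ideal I -> ideal J -> ideal (I `&` J).
Proof.
move=> [I0 ID IM] [J0 JD JM]; split=> [//|x y [? ?] [? ?]|a x [? ?]].
- by split; [exact: ID|exact: JD].
- by split; [exact: IM|exact: JM].
Qed.

Lemma ideal_smallest S : ideal (smallest ideal S).
Proof.
split=> [J [[]] //|x y Sx Sy J iJ|a x Sx J iJ].
- by have [[_ JD _] _] := iJ; apply: JD; [exact: Sx|exact: Sy].
- by have [[_ _ JM] _] := iJ; apply: JM; exact: Sx.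
Qed.

Lemma maximal_prime : maximal_ideal `<=` prime_ideal.
Proof.
move=> M [iM M1 Mmax]; split=> // x y Mxy.
have [M0 MD MM] := iM.
apply: contrapT => /not_orP[nMx nMy].
pose N := [set z | exists a m, M m /\ z = a * x + m].
have iN : ideal N.
  split.
  - by exists 0, 0; rewrite mul0r addr0.
  - move=> _ _ [a [m [Mm ->]]] [b [p [Mp ->]]].
    by exists (a + b), (m + p); rewrite mulrDl addrACA; split=> //; exact: MD.
  - move=> c _ [a [m [Mm ->]]]; exists (c * a), (c * m).
    by rewrite mulrDr mulrA; split=> //; exact: MM.
have MN : M `<=` N by move=> z Mz; exists 0, z; rewrite mul0r add0r.
have Nx : N x by exists 1, 0; rewrite mul1r addr0.
have [N1|nN1] := pselect (N 1); last by rewrite -(Mmax N iN MN nN1) in nMx.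
have [a [m [Mm e]]] := N1.
apply: nMy; rewrite -[y]mul1r e mulrDl -mulrA.
by apply: MD; [exact: MM|rewrite mulrC; exact: MM].
Qed.

End Ideals.

(* A set [X] of prime ideals as a topological space. Primality is what makes
   the sets {P in X | I `<=` P} the closed sets of a topology. *)
Definition zariski (R : comNzRingType) (X : set (set R))
    (X_prime : X `<=` @prime_ideal R) : Type :=
  {P : set R | X P}.

Section Zariski.
Variables (R : comNzRingType) (X : set (set R)).
Hypothesis X_prime : X `<=` @prime_ideal R.

Definition zariski_locus (I : set R) : set (zariski X_prime) :=
  [set P | I `<=` sval P].

Definition zariski_open (U : set (zariski X_prime)) : Prop :=
  exists2 I, ideal I & U = ~` zariski_locus I.

Lemma zariski_openT : zariski_open setT.
Proof.
exists setT; first exact: idealT.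
apply/esym; rewrite -subTset => -[P XP] _ /= sP.
by have [_ nP1 _] := X_prime XP; apply: nP1; exact: sP.
Qed.

Lemma zariski_openI : setI_closed zariski_open.
Proof.
move=> _ _ [I iI ->] [J iJ ->]; exists (I `&` J); first exact: idealI.
rewrite -setCU; congr (~` _); apply/seteqP; split=> -[P XP] /=.
  by case=> sP x [Ix Jx]; [exact: (sP x Ix)|exact: (sP x Jx)].
have [_ _ Pp] := X_prime XP; move=> sP.
have {}sP x : I x -> J x -> P x by move=> Ix Jx; exact: (sP x (conj Ix Jx)).
apply: contrapT => /not_orP[/existsNP[x /not_implyP[Ix nPx]]].
move=> /existsNP[y /not_implyP[Jy nPy]].
suff /Pp[] : P (x * y) by [].
apply: sP; last by have [_ _ JM] := iJ; exact: JM.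
by have [_ _ IM] := iI; rewrite mulrC; exact: IM.
Qed.

Lemma zariski_open_bigU (T : Type) (U : T -> set (zariski X_prime)) :
  (forall i, zariski_open (U i)) -> zariski_open (\bigcup_i U i).
Proof.
move=> oU; have /choice[I IU] : forall i, exists J,
    ideal J /\ U i = ~` zariski_locus J.
  by move=> i; have [J iJ e] := oU i; exists J.
exists (smallest (@ideal R) (\bigcup_i I i)); first exact: ideal_smallest.
rewrite -[LHS]setCK setC_bigcup; congr (~` _); apply/seteqP; split=> -[P XP].
  move=> UP x; apply; split; first by have [] := X_prime XP.
  by move=> y [i _ Iy]; have := UP i Logic.I; rewrite (IU i).2 setCK; apply.
move=> sP i _; rewrite (IU i).2 setCK => y Iy.
by apply: (sP y) => J [_]; apply; exists i.
Qed.

HB.instance Definition _ := gen_eqMixin (zariski X_prime).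
HB.instance Definition _ := gen_choiceMixin (zariski X_prime).
HB.instance Definition _ := isOpenTopological.Build (zariski X_prime)
  zariski_openT zariski_openI zariski_open_bigU.

Lemma zariski_closedP (W : set (zariski X_prime)) :
  closed W <-> exists2 I, ideal I & W = [set P | I `<=` sval P].
Proof.
rewrite -openC; split=> -[I iI e]; exists I => //.
  by rewrite -[LHS]setCK e setCK.
by rewrite e.
Qed.

End Zariski.

Notation max_spec R := (zariski (@maximal_prime R)).

Definition topological_quotient (X Y : topologicalType) (f : X -> Y) : Prop :=
  range f = setT /\ forall W : set Y, closed W <-> closed (f @^-1` W).

Section Differential.
Variables (k : fieldType) (R : comAlgType k).
Implicit Types (d : R -> R) (D : set (R -> R)) (I J : set R).

Definition derivation : set (R -> R) :=
  [set d | linear d /\ forall a b, d (a * b) = d a * b + a * d b].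

Definition delta_stable D I : Prop := forall d, D d -> d @` I `<=` I.

Definition delta_ideal D I : Prop := ideal I /\ delta_stable D I.

Definition delta_core D J : set R :=
  \bigcup_(I in [set I | delta_ideal D I /\ I `<=` J]) I.

Definition delta_primitive D : set (set R) :=
  [set P | exists2 M, maximal_ideal M & P = delta_core D M].

Lemma derivationD d : derivation d -> {morph d : x y / x + y}.
Proof. by move=> [l _] x y; have := l 1 x y; rewrite !scale1r. Qed.

Lemma derivation0 d : derivation d -> d 0 = 0.
Proof.
by move=> dd; apply: (@addrI _ (d 0)); rewrite -derivationD // !addr0.
Qed.

Lemma delta_core_sub D J : delta_core D J `<=` J.
Proof. by move=> x [I [_ sIJ] Ix]; exact: sIJ. Qed.

Lemma delta_core_max D I J : delta_ideal D I -> I `<=` J -> I `<=` delta_core D J.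
Proof. by move=> iI sIJ x Ix; exists I. Qed.

Lemma delta_core_ideal D J : D `<=` derivation -> ideal J ->
  delta_ideal D (delta_core D J).
Proof.
move=> derD [J0 JD JM]; split; [split|].
- exists [set 0] => //; split; last by move=> _ ->.
  split; first split=> // [x y -> ->|a x ->]; rewrite ?addr0 ?mulr0 //.
  by move=> d /derD dd _ [_ -> <-] /=; rewrite derivation0.
- move=> x y [I1 [[[I10 I1D I1M] I1d] I1J] I1x].
  move=> [I2 [[[I20 I2D I2M] I2d] I2J] I2y].
  exists [set z | exists a b, [/\ I1 a, I2 b & z = a + b]]; last by exists x, y.
  split; last by move=> _ [a [b [/I1J Ja /I2J Jb ->]]]; exact: JD.
  split; first split.
  + by exists 0, 0; rewrite addr0.
  + move=> _ _ [a [b [Ia Ib ->]]] [a' [b' [Ia' Ib' ->]]].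
    by exists (a + a'), (b + b'); rewrite addrACA; split=> //;
      [exact: I1D|exact: I2D].
  + move=> c _ [a [b [Ia Ib ->]]].
    by exists (c * a), (c * b); rewrite mulrDr; split=> //;
      [exact: I1M|exact: I2M].
  + move=> d Dd _ [_ [a [b [Ia Ib ->]]] <-].
    exists (d a), (d b); rewrite (derivationD (derD _ Dd)); split=> //.
    * by apply: (I1d d Dd); exists a.
    * by apply: (I2d d Dd); exists b.
- by move=> a x [I iI Ix]; exists I => //; have [[[_ _ IM] _] _] := iI; exact: IM.
- move=> d Dd _ [x [I iI Ix] <-]; exists I => //.
  by have [[_ Id] _] := iI; apply: (Id d Dd); exists x.
Qed.

Section CorePrime.
Hypothesis k0 : [pchar k] =i pred0.

Lemma iter_derM_lt d (P : set R) n m j a b : derivation d -> ideal P ->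
  (forall i, (i < n)%N -> P (iter i d a)) ->
  (forall i, (i < m)%N -> P (iter i d b)) ->
  (j < n + m)%N -> P (iter j d (a * b)).
Proof.
move=> dd [P0 PD PM]; have itD i x y : iter i d (x + y) = iter i d x + iter i d y.
  by elim: i => //= i ->; rewrite derivationD.
elim: j n m a b => [|j IH] n m a b Pa Pb jnm.
  case: n Pa jnm => [|n] Pa; last by rewrite mulrC => _; exact/PM/(Pa 0%N).
  by rewrite add0n => m0; exact/PM/(Pb 0%N).
rewrite iterSr dd.2 itD; apply: PD.
  apply: (IH n.-1 m) => //; last by lia.
  by move=> i ?; rewrite -iterSr; apply: Pa; lia.
apply: (IH n m.-1) => //; last by lia.
by move=> i ?; rewrite -iterSr; apply: Pb; lia.
Qed.

Lemma iter_derM d (P : set R) n m a b : derivation d -> ideal P ->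
  (forall i, (i < n)%N -> P (iter i d a)) ->
  (forall i, (i < m)%N -> P (iter i d b)) ->
  P (iter (n + m) d (a * b) - (iter n d a * iter m d b) *+ 'C(n + m, n)).
Proof.
move=> dd iP; have [P0 PD PM] := iP.
have itD i x y : iter i d (x + y) = iter i d x + iter i d y.
  by elim: i => //= i ->; rewrite derivationD.
move: {2}(n + m)%N (erefl (n + m)%N) => j.
elim: j n m a b => [|j IH] n m a b e Pa Pb.
  have [-> ->] : n = 0%N /\ m = 0%N by lia.
  by rewrite bin0 /= subrr.
have split_iter : iter (n + m) d (a * b) = iter j d (d a * b) + iter j d (a * d b).
  by rewrite e iterSr dd.2 itD.
case: n e Pa split_iter => [|n] e Pa ->.
  rewrite add0n bin0 mulr1n.
  have -> : m = j.+1 by lia.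
  rewrite -addrA; apply: PD.
    by apply: (@iter_derM_lt d P 0 m) => //; lia.
  have := IH 0%N j a (d b); rewrite add0n bin0 mulr1n -iterSr; apply=> //.
  by move=> i ?; rewrite -iterSr; apply: Pb; lia.
case: m e Pb => [|m] e Pb.
  have ej : n = j by lia.
  rewrite addn0 binn mulr1n addrAC; apply: PD.
    have := IH n 0%N (d a) b; rewrite addn0 binn mulr1n -iterSr ej; apply=> //.
    by move=> i ?; rewrite -iterSr; apply: Pa; lia.
  apply: (@iter_derM_lt d P n.+1 0) => //; lia.
have N1 : (n + m.+1)%N = j by lia.
have N2 : (n.+1 + m)%N = j by lia.
have Px : P (iter j d (d a * b) - (iter n.+1 d a * iter m.+1 d b) *+ 'C(j, n)).
  have := IH n m.+1 (d a) b; rewrite -iterSr N1; apply=> //.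
  by move=> i ?; rewrite -iterSr; apply: Pa; lia.
have Py : P (iter j d (a * d b) - (iter n.+1 d a * iter m.+1 d b) *+ 'C(j, n.+1)).
  have := IH n.+1 m a (d b); rewrite -iterSr N2; apply=> //.
  by move=> i ?; rewrite -iterSr; apply: Pb; lia.
by rewrite e binS addnC mulrnDr opprD addrACA; exact: PD.
Qed.

Lemma natr_ideal (P : set R) n x : ideal P -> P (x *+ n.+1) -> P x.
Proof.
move=> [_ _ PM] Px.
have n0 : n.+1%:R != 0 :> k by rewrite (pcharf0P k).1.
have -> : x = (n.+1%:R^-1 : k)%:A * (x *+ n.+1).
  by rewrite -scalerAl mul1r -scaler_nat scalerA mulVf // scale1r.
exact: PM.
Qed.

(* {x | d^n x in P for all n}: the core of [P] for a single derivation *)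
Lemma iter_core_prime d (P : set R) : derivation d -> prime_ideal P ->
  prime_ideal [set x | forall n, P (iter n d x)].
Proof.
move=> dd [iP P1 Pp]; have [P0 PD PM] := iP.
have itD i x y : iter i d (x + y) = iter i d x + iter i d y.
  by elim: i => //= i ->; rewrite derivationD.
split; first split.
- move=> n; suff -> : iter n d 0 = 0 by [].
  by elim: n => //= n ->; rewrite derivation0.
- by move=> x y Px Py n; rewrite itD; exact: PD.
- move=> a x Px n; rewrite mulrC.
  by apply: (@iter_derM_lt d P n.+1 0) => //; lia.
- by move/(_ 0%N).
move=> a b Pab; apply: contrapT => /not_orP[].
move=> /existsNP[n0 nPa] /existsNP[m0 nPb].
have exa : exists n, `[< ~ P (iter n d a) >] by exists n0; apply/asboolP.
have exb : exists m, `[< ~ P (iter m d b) >] by exists m0; apply/asboolP.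
case: (ex_minnP exa) => n /asboolP na an; case: (ex_minnP exb) => m /asboolP mb bm.
have Pa i : (i < n)%N -> P (iter i d a).
  move=> lt_in; apply: contrapT => /asboolP /an; lia.
have Pb i : (i < m)%N -> P (iter i d b).
  move=> lt_im; apply: contrapT => /asboolP /bm; lia.
have := iter_derM dd iP Pa Pb.
have := Pab (n + m)%N; set z := iter _ d _ => Pz Pzw.
have {Pzw} : P ((iter n d a * iter m d b) *+ 'C(n + m, n)).
  by have := idealB iP Pz Pzw; rewrite opprB addrC subrK.
have : (0 < 'C(n + m, n))%N by rewrite bin_gt0 leq_addr.
by case: 'C(_, _) => // c _ /natr_ideal -/(_ iP) /Pp[].
Qed.

Lemma bigcap_prime (F : set (set R)) : F !=set0 -> F `<=` @prime_ideal R ->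
  total_on F subset -> prime_ideal (\bigcap_(P in F) P).
Proof.
move=> [P0 FP0] Fp Ft; split; first split.
- by move=> P /Fp [[]].
- by move=> x y Fx Fy P FP; have [[_ PD _] _ _] := Fp _ FP;
    apply: PD; [exact: Fx|exact: Fy].
- by move=> a x Fx P FP; have [[_ _ PM] _ _] := Fp _ FP; apply: PM; exact: Fx.
- by move/(_ _ FP0); have [] := Fp _ FP0.
move=> x y Fxy; apply: contrapT => /not_orP[].
move=> /existsNP[P /not_implyP[FP nPx]] /existsNP[Q /not_implyP[FQ nQy]].
have [PQ|QP] := Ft _ _ FP FQ.
- by have [_ _ Pp] := Fp _ FP; have [//|/PQ] := Pp _ _ (Fxy _ FP).
- by have [_ _ Qp] := Fp _ FQ; have [/QP|] := Qp _ _ (Fxy _ FQ).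
Qed.

(* A prime minimal among those between the core and [P] is [D]-stable, so it is
   the core. *)
Lemma delta_core_prime D P : D `<=` derivation -> prime_ideal P ->
  prime_ideal (delta_core D P).
Proof.
move=> derD pP; have [iP _ _] := pP.
have [iC dC] := delta_core_ideal derD iP.
pose T := {Q : set R | [/\ prime_ideal Q, delta_core D P `<=` Q & Q `<=` P]}.
pose mkT Q pQ CQ QP : T := exist _ Q (And3 pQ CQ QP).
pose t0 := mkT P pP (@delta_core_sub D P) (@subset_refl _ P).
have [] := @Zorn T (fun Q Q' => `[< sval Q' `<=` sval Q >]).
- by move=> Q; apply/asboolP.
- move=> Q1 Q2 Q3 /asboolP s21 /asboolP s32.
  by apply/asboolP; exact: subset_trans s21.
- move=> [Q1 p1] [Q2 p2] /asboolP /= s21 /asboolP /= s12.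
  have e : Q1 = Q2 by apply/seteqP.
  by subst Q2; congr exist; exact: Prop_irrelevance.
- move=> A Atot; have [[Q0 AQ0]|] := pselect (A !=set0); last first.
    by move=> nA; exists t0 => s As; case: nA; exists s.
  pose F := [set Q | exists2 q, A q & Q = sval q].
  have Fp : prime_ideal (\bigcap_(Q in F) Q).
    apply: bigcap_prime; first by exists (sval Q0), Q0.
      by move=> _ [q _ ->]; have [] := svalP q.
    move=> _ _ [q Aq ->] [q' Aq' ->].
    by have [/asboolP|/asboolP] := Atot _ _ Aq Aq'; [right|left].
  have F1 : delta_core D P `<=` \bigcap_(Q in F) Q.
    by move=> x Cx _ [q _ ->]; have [_ s _] := svalP q; exact: s.
  have F2 : \bigcap_(Q in F) Q `<=` P.
    move=> x Fx; have [_ _ s] := svalP Q0; apply: s; apply: Fx.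
    by exists Q0.
  exists (mkT _ Fp F1 F2) => q Aq; apply/asboolP => /= x Fx.
  by apply: Fx; exists q.
move=> [Q [pQ CQ QP]] /= Qmin.
have Qd : delta_stable D Q.
  move=> d Dd _ [x Qx <-]; have dd := derD _ Dd.
  have pK := iter_core_prime dd pQ; set K := [set _ | _] in pK.
  have KQ : K `<=` Q by move=> y /(_ 0%N).
  have CK : delta_core D P `<=` K.
    move=> y Cy n; apply: (CQ _); elim: n => //= n Cn.
    by apply: (dC _ Dd); exists (iter n d y).
  have := Qmin (mkT K pK CK (subset_trans KQ QP)).
  move/(_ (introT (asboolP _) KQ)) => /(congr1 sval) /= eKQ.
  by have /(_ 1%N) : K x by rewrite eKQ.
suff -> : delta_core D P = Q by [].
apply/seteqP; split => //; apply: delta_core_max => //.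
by split=> //; have [] := pQ.
Qed.

Lemma delta_primitive_prime D : D `<=` derivation ->
  delta_primitive D `<=` @prime_ideal R.
Proof.
by move=> derD _ [M /maximal_prime pM ->]; exact: delta_core_prime.
Qed.

End CorePrime.
End Differential.

Arguments derivation {k R}.

Notation delta_prim k0 derD := (zariski (delta_primitive_prime k0 derD)).

Definition pi_m (k : fieldType) (k0 : [pchar k] =i pred0) (R : comAlgType k)
    (D : set (R -> R)) (derD : D `<=` derivation) (Q : max_spec R) :
    delta_prim k0 derD :=
  exist _ (delta_core D (sval Q)) (ex_intro2 _ _ (sval Q) (svalP Q) erefl).

Definition affine (k : fieldType) (R : comAlgType k) : Prop :=
  exists s : seq R, forall S : {pred R},
    GRing.subalg_closed S -> {subset s <= S} -> forall x, x \in S.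

(* The torus (k^x)^r, with coordinatewise multiplication. *)
Definition torus (k : fieldType) (r : nat) : Type :=
  {h : {ffun 'I_r -> k} | [forall i, h i != 0]}.

HB.instance Definition _ (k : fieldType) (r : nat) :=
  Choice.on (torus k r).

Section Torus.
Variables (k : fieldType) (r : nat).
Implicit Types g h : torus k r.

Lemma torus_neq0 h i : val h i != 0.
Proof. by have /forallP := valP h. Qed.

Definition torus_of (u : 'I_r -> k) (u0 : forall i, u i != 0) : torus k r :=
  exist _ (finfun u) (introT forallP (fun i =>
    eq_ind_r (fun x => x != 0) (u0 i) (ffunE u i))).

Lemma torus_ofE u u0 i : val (@torus_of u u0) i = u i.
Proof. by rewrite ffunE. Qed.

Lemma torusP g h : (forall i, val g i = val h i) -> g = h.
Proof. by move=> e; apply/val_inj/ffunP. Qed.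

Definition torus_one := torus_of (fun _ => oner_neq0 k).
Definition torus_mul g h :=
  torus_of (fun i => mulf_neq0 (torus_neq0 g i) (torus_neq0 h i)).
Definition torus_inv h := torus_of (fun i => invr_neq0 (torus_neq0 h i)).

Lemma torus_mulA : associative torus_mul.
Proof. by move=> f g h; apply: torusP => i; rewrite !torus_ofE mulrA. Qed.
Lemma torus_mul1 : left_id torus_one torus_mul.
Proof. by move=> h; apply: torusP => i; rewrite !torus_ofE mul1r. Qed.
Lemma torus_mulr1 : right_id torus_one torus_mul.
Proof. by move=> h; apply: torusP => i; rewrite !torus_ofE mulr1. Qed.
Lemma torus_mulV : left_inverse torus_one torus_inv torus_mul.
Proof. by move=> h; apply: torusP => i; rewrite !torus_ofE mulVf ?torus_neq0. Qed.
Lemma torus_mulrV : right_inverse torus_one torus_inv torus_mul.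
Proof. by move=> h; apply: torusP => i; rewrite !torus_ofE divff ?torus_neq0. Qed.

HB.instance Definition _ := isGroup.Build (torus k r)
  torus_mulA torus_mul1 torus_mulr1 torus_mulV torus_mulrV.

(* The coordinate ring of (k^x)^r consists of the Laurent polynomials
   \sum_t c_t x^(m_t). *)
Definition regular_function (f : torus k r -> k) : Prop :=
  exists s : seq (k * {ffun 'I_r -> int}), forall h,
    f h = \sum_(t <- s) t.1 * \prod_i val h i ^ t.2 i.

Definition rational_character (f : torus k r -> k) : Prop :=
  [/\ forall h, f h != 0, forall g h, f (g * h)%g = f g * f h
    & regular_function f].

End Torus.

(* The subset [A] of [V] is the internal direct sum of the family [W]. *)
Definition direct_sum_of (V : zmodType) (I : Type) (A : set V)
    (W : I -> set V) : Prop :=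
  [/\ forall i, W i `<=` A,
      forall v, A v -> exists n (e : 'I_n -> I) (w : 'I_n -> V),
        (forall j, W (e j) (w j)) /\ v = \sum_j w j &
      forall n (e : 'I_n -> I) (w : 'I_n -> V), injective e ->
        (forall j, W (e j) (w j)) -> \sum_j w j = 0 -> forall j, w j = 0].

Section RationalAction.
Variables (k : fieldType) (r : nat).

Definition eigenspace (V : lmodType k) (A : set V) (a : torus k r -> V -> V)
    (f : torus k r -> k) : set V :=
  [set v | A v /\ forall h, a h v = f h *: v].

Definition rational_on (V : lmodType k) (A : set V)
    (a : torus k r -> V -> V) : Prop :=
  direct_sum_of A (eigenspace A a) /\
  forall f v, v != 0 -> eigenspace A a f v -> rational_character f.

Variable R : comAlgType k.
Implicit Types (act : torus k r -> {lrmorphism R -> R}) (D : set (R -> R)).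

Definition group_action act : Prop :=
  act 1%g =1 id /\ forall g h, act (g * h)%g =1 act g \o act h.

Definition der_act act (h : torus k r) (d : R -> R) : R -> R :=
  act h \o d \o act h^-1%g.

Definition acts_rationally act D : Prop :=
  [/\ group_action act /\ rational_on setT act,
      [/\ D `<=` derivation, D 0,
          forall (c : k) d d', D d -> D d' -> D (c *: d + d') &
          forall h d, D d -> D (der_act act h d)] &
      rational_on D (der_act act)].

Definition prime_HD_ideal act D (P : set R) : Prop :=
  [/\ prime_ideal P, forall h, act h @` P `<=` P & delta_stable D P].

End RationalAction.

(* Main.v *)
(* The fibre of pi_m over a primitive ideal P = (M0 : D) is dense in the closed
   set V(P) of maximal ideals containing P. Hence, if the preimage of W is V(I),
   then I is contained in every P in W, and W is the closed set defined by I.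

   Density follows from the Nullstellensatz once P is locally closed: some g
   outside P lies in every maximal ideal M containing P with (M : D) <> P. Take
   for g a common element of the finitely many prime (H,D)-ideals that are not
   contained in P, and let Q = (M : D) contain P strictly, with g not in M. The
   largest H-stable ideal inside Q is a prime (H,D)-ideal without g, so it lies
   in P. Choose x in Q outside P that is a sum of as few H-eigenvectors as
   possible, and let y be one of them; then y is not in Q. For every
   H-eigenvector d in D the element y d(x) - x d(y) of Q is a shorter sum, hence
   is in P, so x / y is a D-constant of the fraction field of R / P. Since M0
   contains no D-ideal outside P, such constants embed into the residue field
   R / M0 and are algebraic over k; but x is in Q and y is not, so an algebraic
   relation of x / y over k, read modulo Q, would have zero constant term. *)
From HB Require Import structures.
From mathcomp Require Import all_boot all_algebra.
From mathcomp Require Import all_classical topology ring zify.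
Require Import Defs.

Set Implicit Arguments.
Unset Strict Implicit.
Unset Printing Implicit Defensive.

Import GRing.Theory.
Local Open Scope classical_set_scope.
Local Open Scope ring_scope.

(** * Residue fields of primes *)

Section PrimeQuotientDomain.
Variables (R : comNzRingType) (I : prime_idealr R).
Local Notation Q := (Quotient.quot I).
Implicit Types x y : Q.

(** The fraction field is formed over a domain with a total inverse, so units are recognised and
    their inverses chosen classically. *)
Definition quot_unit : {pred Q} := fun x => `[< exists y, y * x = 1 >].

Definition quot_inv x : Q :=
  if x \in quot_unit then xget x [set y | y * x = 1] else x.

Let quot_mulVx : {in quot_unit, left_inverse 1 quot_inv *%R}.
Proof.
move=> x Ux; rewrite /quot_inv Ux.
have /asboolP/(xgetPex x) := Ux; exact.
Qed.

Let quot_unitPl x y : y * x = 1 -> quot_unit x.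
Proof. by move=> yx; apply/asboolP; exists y. Qed.

Let quot_invx_out : {in [predC quot_unit], quot_inv =1 id}.
Proof. by move=> x /negPf; rewrite /quot_inv => ->. Qed.

HB.instance Definition _ := GRing.ComNzRing_hasMulInverse.Build Q
  quot_mulVx quot_unitPl quot_invx_out.
HB.instance Definition _ := GRing.ComUnitRing_isIntegral.Build Q
  (@Quotient.rquot_IdomainAxiom R I).

End PrimeQuotientDomain.

(** Carrying the primality proof as an argument lets the ideal structures be attached to the
    predicate. *)
Definition prime_pred (R : comNzRingType) (Q : set R)
  (Q_prime : prime_ideal Q) : {pred R} := fun x => `[< Q x >].

Section PrimeKernel.
Variables (R : comNzRingType) (Q : set R) (Q_prime : prime_ideal Q).
Local Open Scope quotient_scope.

Lemma prime_predP x : reflect (Q x) (x \in prime_pred Q_prime).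
Proof. exact: asboolP. Qed.

Let prime_pred_idealr : idealr_closed (prime_pred Q_prime).
Proof.
have [[Q0 QD QM] Q1 _] := Q_prime.
split=> [||a x y /prime_predP Qx /prime_predP Qy]; first exact/prime_predP.
  by apply/negP => /prime_predP.
by apply/prime_predP/QD => //; exact: QM.
Qed.

HB.instance Definition _ := isIdealr.Build R (prime_pred Q_prime)
  prime_pred_idealr.

Let prime_pred_prime : prime_idealr_closed (prime_pred Q_prime).
Proof.
have [_ _ Qp] := Q_prime.
by move=> x y /prime_predP/Qp[] /prime_predP -> //; rewrite orbT.
Qed.

HB.instance Definition _ := isPrimeIdealrClosed.Build R (prime_pred Q_prime)
  prime_pred_prime.

Lemma prime_ideal_kernel : exists (L : fieldType) (psi : {rmorphism R -> L}),
  forall x, psi x = 0 <-> Q x.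
Proof.
pose D := {ideal_quot prime_pred Q_prime}.
pose pi : {rmorphism R -> D} := \pi_D.
exists {fraction D}, (@tofrac D \o pi : {rmorphism R -> {fraction D}}) => x /=.
rewrite (rwP eqP) tofrac_eq0 -(rmorph0 pi) /pi.
rewrite -Quotient.idealrBE subr0.
by split=> /prime_predP.
Qed.

End PrimeKernel.

(** * The Nullstellensatz *)

Section GDomain.
Variable L : fieldType.

(* The image of [phi] has a fraction field generated by one inverse. *)
Definition g_domain (A : comNzRingType) (phi : A -> L) : Prop :=
  exists2 f, phi f != 0 &
    forall a, phi a != 0 -> exists b n, phi a * phi b = phi f ^+ n.

(** Once the power of [w] is cancelled in a monic equation of [w], the lowest nonzero coefficient is
    minus [w] times a polynomial in [w]. *)
Lemma integral_dvd (A : comNzRingType) (phi : {rmorphism A -> L}) w : w != 0 ->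
  integralOver phi w ->
  exists2 c, phi c != 0 & integralOver phi (phi c / w).
Proof.
move=> w0 [q q_mon]; set P := map_poly phi q => Pw.
have P0 : P != 0 by exact/monic_neq0/monic_map.
have exm : exists m, P`_m != 0.
  by exists (size P).-1; rewrite -[_`__]/(lead_coef P) lead_coef_eq0.
case: (ex_minnP exm) => m Pm mmin.
have e : P = P`_m *: 'X^m + drop_poly m.+1 P * 'X^(m.+1).
  rewrite -{1}[P](poly_take_drop m.+1); congr (_ + _).
  apply/polyP => i; rewrite coef_take_poly coefZ coefXn ltnS.
  case: ltngtP => [im|im|->]; rewrite ?mulr0 ?mulr1 //.
  by apply: contraTeq im => /mmin; rewrite leqNgt.
exists q`_m; first by rewrite -coef_map.
move/rootP: (Pw); rewrite e hornerD hornerZ hornerM !hornerXn exprSr mulrA.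
rewrite mulrAC -mulrDl => /eqP; rewrite mulf_eq0 expf_eq0 (negPf w0) andbF orbF.
rewrite coef_map addr_eq0 => /eqP ->; rewrite -mulNr mulfK //.
apply/integral_opp/integral_horner; last first.
  by exists q.
by apply/(integral_poly phi) => i; rewrite coef_drop_poly coef_map;
  exact: integral_id.
Qed.

Lemma integral_div_range (B : comNzRingType) (phi : {rmorphism B -> L}) C s :
  phi s != 0 -> integralOver phi (phi C / phi s) ->
  exists d e, phi C ^+ d = phi s * phi e.
Proof.
move=> s0 [p p_mon /rootP]; rewrite horner_coef size_map_poly_id0; last first.
  by rewrite (monicP p_mon) rmorph1 oner_neq0.
rewrite (polySpred (monic_neq0 p_mon)); set d := (size p).-1.
rewrite big_ord_recr /= coef_map /= [p`_d](monicP p_mon) rmorph1 mul1r.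
move/(congr1 ( *%R^~ (phi s ^+ d))); rewrite mul0r mulrDl -exprMn divfK //.
rewrite addrC => /eqP; rewrite addr_eq0 => /eqP Cd.
(* After multiplication by [s ^+ d], each term with [i < d] has a factor [s]; taking it out leaves
   the exponent [d.-1 - i]. *)
exists d, (- \sum_(i < d) p`_i * C ^+ i * s ^+ (d.-1 - i)).
rewrite Cd rmorphN mulrN; congr (- _); rewrite rmorph_sum mulr_suml mulr_sumr.
apply: eq_bigr => i _; rewrite coef_map !rmorphM !rmorphXn exprMn exprVn.
have -> : phi s ^+ d = phi s ^+ i * phi s * phi s ^+ (d.-1 - i).
  by rewrite -exprSr -exprD; congr (_ ^+ _); have := ltn_ord i; lia.
by field; rewrite expf_neq0.
Qed.

Variables (A : comNzRingType) (phi : {rmorphism A -> L}).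

Definition adjoin (x : L) : {rmorphism {poly A} -> L} :=
  horner_morph (fun a => mulrC x (phi a)).

Lemma adjoinE x p : adjoin x p = (map_poly phi p).[x].
Proof. by []. Qed.

Lemma adjoinC x a : adjoin x a%:P = phi a.
Proof. exact: horner_morphC. Qed.

Lemma adjoinX x : adjoin x 'X = x.
Proof. exact: horner_morphX. Qed.

Lemma adjoin_inv u c : phi u != 0 ->
  exists b n, adjoin (phi u)^-1 c * phi u ^+ n = phi b.
Proof.
move=> u0; elim/poly_ind: c => [|c a [b [n e]]].
  by exists 0, 0; rewrite !rmorph0 mul0r.
exists (b + a * u ^+ n.+1), n.+1.
rewrite !rmorphD !rmorphM adjoinX adjoinC rmorphXn -e exprS.
by field.
Qed.

(* If [x] were transcendental, [1 + x f] would divide a power of [f] in a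
   polynomial ring, although it is coprime to [f]. *)
Lemma g_domain_adjoin_algebraic x : g_domain (adjoin x) ->
  exists2 p, map_poly phi p != 0 & root (map_poly phi p) x.
Proof.
move=> [f f0 fG]; apply: contrapT => nalg.
have inj p : adjoin x p = 0 -> map_poly phi p = 0.
  move=> px; apply: contrapT => /eqP p0; apply: nalg; exists p => //.
  exact/rootP.
set F := map_poly phi f.
have F0 : F != 0 by apply: contraNneq f0; rewrite adjoinE -/F => ->; rewrite horner0.
have E : map_poly phi (1 + 'X * f) = 1 + 'X * F.
  by rewrite rmorphD rmorphM rmorph1 /= map_polyX.
have sz : (1 < size (1 + 'X * F)%R)%N.
  rewrite addrC mulrC size_polyDl size_mulX // ?size_poly1 ltnS size_poly_gt0 //.
have : adjoin x (1 + 'X * f) != 0.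
  apply: contraTneq sz => /inj; rewrite E => ->; by rewrite size_poly0.
move=> /fG[b [n /eqP]]; rewrite -rmorphM -rmorphXn -subr_eq0 -rmorphB.
move=> /eqP/inj/eqP.
rewrite rmorphB subr_eq0 rmorphM rmorphXn /= E => /eqP e.
have cop : coprimep (1 + 'X * F) F.
  apply/Bezout_eq1_coprimepP; exists (1, - 'X) => /=; ring.
have : coprimep (1 + 'X * F) (F ^+ n) by rewrite coprimep_expr.
rewrite -e /coprimep => /eqP; have /eqp_size -> :=
  gcdp_mulr (map_poly phi b) (1 + 'X * F).
by move=> s1; rewrite s1 in sz.
Qed.

(** Inverting the leading coefficient [a] of an equation of [x] makes the image of [adjoin x]
    integral over that of [loc]. Then [f] divides some nonzero [c] of the localization with integral
    quotient. A nonzero [phi s] divides a power of [f], so it divides a power of [c] up to integral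
    elements, and a further power inside the localization. Clearing denominators, it divides a power
    of [a * c']. *)
Lemma g_domain_adjoin x : g_domain (adjoin x) -> g_domain phi.
Proof.
move=> xG; have [p] := g_domain_adjoin_algebraic xG.
set P := map_poly phi p => P0 Px; case: xG => f f0 fG.
pose a := p`_(size P).-1.
have aE : phi a = lead_coef P by rewrite /lead_coef coef_map.
have a0 : phi a != 0 by rewrite aE lead_coef_eq0.
pose loc := adjoin (phi a)^-1.
have intA z : integralOver loc (phi z) by rewrite -(adjoinC (phi a)^-1);
  exact: integral_id.
have intx : integralOver loc x.
  apply: (@integral_root_monic _ _ _ _ ((phi a)^-1 *: P)).
  - by rewrite monicE lead_coefZ -aE mulVf.
  - by rewrite rootZ ?invr_eq0.
  - apply/(integral_poly loc) => i; rewrite coefZ coef_map.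
    apply: integral_mul (intA _).
    by rewrite -(adjoinX (phi a)^-1); exact: integral_id.
have intE q : integralOver loc (adjoin x q).
  rewrite adjoinE; apply: integral_horner intx.
  by apply/(integral_poly loc) => j; rewrite coef_map; exact: intA.
have [c c0 intc] := integral_dvd f0 (intE f).
have [c' [N c'E]] := adjoin_inv c a0.
have c'0 : phi c' != 0 by rewrite -c'E mulf_neq0 // expf_neq0.
exists (a * c'); first by rewrite rmorphM mulf_neq0.
move=> s s0; have [|b [n]] := fG s%:P; rewrite adjoinC // => bE.
have : integralOver loc (loc (c ^+ n) / loc s%:P).
  rewrite /loc adjoinC rmorphXn.
  have -> : adjoin (phi a)^-1 c ^+ n / phi s =
     adjoin x b * (adjoin (phi a)^-1 c / adjoin x f) ^+ n.
    have := expf_neq0 n f0; rewrite -bE mulf_eq0 negb_or => /andP[_ b0].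
    by rewrite exprMn exprVn -bE; field; rewrite b0.
  apply: integral_mul (intE b) _.
  by elim: n {bE} => [|n IH]; [exact: integral1|rewrite exprS; exact: integral_mul].
move/integral_div_range; rewrite {1}/loc adjoinC => /(_ s0) [d [e]].
rewrite rmorphXn -exprM; have [e' [M e'E]] := adjoin_inv e a0.
rewrite /loc; move: (n * d)%N => K sE.
(* [a ^+ (N * K)] turns the [K]-th power of [c] into that of [c'], and [e'] contains [a ^+ M]; the
   remaining factors complete [(a * c') ^+ (K + M)]. *)
exists (e' * a ^+ (N * K) * a ^+ K * c' ^+ M), (K + M)%N.
rewrite !(rmorphM, rmorphXn) -e'E exprMn [phi c' ^+ (K + M)]exprD.
by rewrite -{2}c'E exprMn sE exprM !exprD; ring.
Qed.

End GDomain.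

(* The polynomial rings iterated over [k] stand for the subalgebras of [L]
   generated by the successive elements of [s]. *)
Lemma g_domain_tower (k L : fieldType) (iota : {rmorphism k -> L}) (s : seq L) :
  exists (A : comNzRingType) (phi : {rmorphism A -> L}),
  [/\ range iota `<=` range phi, [set` s] `<=` range phi,
      forall T : set L, (forall c, T (iota c)) -> [set` s] `<=` T ->
        (forall x y, T x -> T y -> T (x + y)) ->
        (forall x y, T x -> T y -> T (x * y)) -> range phi `<=` T &
      g_domain phi -> forall a, algebraicOver iota (phi a)].
Proof.
elim: s => [|x s [A [phi [phik phis phiT phiG]]]].
  exists k, iota; split=> // [T Tk _ _ _ _ [c _ <-] //|_ a].
  exact: algebraic_id.
exists {poly A}, (adjoin phi x); split.
- by move=> _ /phik [a _ <-]; exists a%:P => //; exact: adjoinC.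
- move=> y; rewrite /= inE => /orP[/eqP ->|/phis [a _ <-]].
    by exists 'X => //; exact: adjoinX.
  by exists a%:P => //; exact: adjoinC.
- move=> T Tk Ts TD TM _ [p _ <-].
  have Ta a : T (phi a).
    by apply: (phiT T) => // y sy; apply: Ts; rewrite /= inE sy orbT.
  elim/poly_ind: p => [|p c IH].
    by rewrite rmorph0 -(rmorph0 phi).
  rewrite rmorphD rmorphM adjoinX adjoinC; apply: TD => //; apply: TM => //.
  by apply: Ts; rewrite /= inE eqxx.
- move=> xG.
  have phialg := phiG (g_domain_adjoin xG).
  have xalg : algebraicOver iota x.
    have [p p0 px] := g_domain_adjoin_algebraic xG.
    apply/integral_algebraic; apply: integral_root p0 px _.
    apply/(integral_poly iota) => i; rewrite coef_map.
    exact/integral_algebraic/phialg.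
  elim/poly_ind => [|p c IH]; first by rewrite rmorph0; exact: algebraic0.
  rewrite rmorphD rmorphM adjoinX adjoinC; apply: algebraic_add => //.
  exact: algebraic_mul.
Qed.

Section Affine.
Variables (k : fieldType) (R : comAlgType k).

Definition scalar_embedding (L : fieldType) (psi : {rmorphism R -> L}) :
  {rmorphism k -> L} := psi \o in_alg R.

(** Zariski's lemma for G-domains: [psi] and the map [phi] of the tower have the same range, so the
    G-domain property passes from one to the other. *)
Lemma zariski_algebraic (L : fieldType) (psi : {rmorphism R -> L}) :
  affine R -> g_domain psi ->
  forall a, algebraicOver (scalar_embedding psi) (psi a).
Proof.
move=> [s sR] psiG.
have [A [phi [phik phis phiT phiG]]] :=
  g_domain_tower (scalar_embedding psi) (map psi s).
have sub1 a : exists b, phi b = psi a.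
  suff /asboolP : a \in (fun r => `[< exists b, phi b = psi r >]) by [].
  apply: sR => [|r sr]; last first.
    have [|b _ e] := phis (psi r); last by apply/asboolP; exists b.
    exact: map_f.
  split=> [|c u v /asboolP[bu eu] /asboolP[bv ev]|u v /asboolP[bu eu] /asboolP[bv ev]].
  - by apply/asboolP; exists 1; rewrite !rmorph1.
  - have [|b _ eb] := phik (scalar_embedding psi c); first by exists c.
    apply/asboolP; exists (b * bu + bv).
    by rewrite rmorphD rmorphM eb eu ev rmorphD -mulr_algl rmorphM.
  - by apply/asboolP; exists (bu * bv); rewrite !rmorphM eu ev.
have sub2 b : exists a, psi a = phi b.
  suff /(_ _ (ex_intro2 _ _ b Logic.I erefl)) [a _ <-] : range phi `<=` range psi.
    by exists a.
  apply: phiT => [c|x /mapP[r _ ->]|_ _ [u _ <-] [v _ <-]|_ _ [u _ <-] [v _ <-]].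
  - by exists c%:A.
  - by exists r.
  - by exists (u + v) => //; rewrite rmorphD.
  - by exists (u * v) => //; rewrite rmorphM.
have {}phiG : forall b, algebraicOver (scalar_embedding psi) (phi b).
  apply: phiG; have [f f0 fG] := psiG; have [g ge] := sub1 f.
  exists g; first by rewrite ge.
  move=> b; have [a <-] := sub2 b; move=> /fG[a' [n e]].
  by have [b' e'] := sub1 a'; exists b', n; rewrite e' ge.
by move=> a; have [b <-] := sub1 a.
Qed.

End Affine.

(** * Ideals maximal away from the powers of an element *)

Section Ideals.
Variable R : comNzRingType.
Implicit Types (I M P : set R) (a g x : R).

Definition ideal_adjoin I a : set R :=
  [set z | exists r m, I m /\ z = r * a + m].

Lemma ideal_adjoin_ideal I a : ideal I -> ideal (ideal_adjoin I a).
Proof.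
move=> [I0 ID IM]; split; first by exists 0, 0; rewrite mul0r addr0.
  move=> _ _ [r [m [Im ->]]] [s [n [In ->]]].
  by exists (r + s), (m + n); rewrite mulrDl addrACA; split=> //; exact: ID.
move=> b _ [r [m [Im ->]]]; exists (b * r), (b * m).
by rewrite mulrDr mulrA; split=> //; exact: IM.
Qed.

Lemma ideal_adjoin_sub I a : I `<=` ideal_adjoin I a.
Proof. by move=> x Ix; exists 0, x; rewrite mul0r add0r. Qed.

Lemma ideal_adjoin_mem I a : ideal I -> ideal_adjoin I a a.
Proof. by move=> [I0 _ _]; exists 1, 0; rewrite mul1r addr0. Qed.

Lemma maximal_adjoin1 M a : maximal_ideal M -> ~ M a -> ideal_adjoin M a 1.
Proof.
move=> [iM M1 Mmax] nMa; apply: contrapT => n1; apply: nMa.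
rewrite -(Mmax _ (ideal_adjoin_ideal a iM) (@ideal_adjoin_sub M a) n1).
exact: ideal_adjoin_mem.
Qed.

Lemma prime_exp P g n : prime_ideal P -> ~ P g -> ~ P (g ^+ n).
Proof.
move=> [_ P1 Pp] nPg; elim: n => [|n IH]; first by rewrite expr0.
by rewrite exprS => /Pp[].
Qed.

(** [M] is the trace on [R] of a maximal ideal of the localization at [g]. *)
Lemma exists_maximal_avoiding P g : prime_ideal P -> ~ P g ->
  exists M, [/\ prime_ideal M, P `<=` M, ~ M g &
    forall a, ~ M a -> exists n, ideal_adjoin M a (g ^+ n)].
Proof.
move=> pP nPg.
pose T I := I = set0 \/ [/\ ideal I, P `<=` I & forall n, ~ I (g ^+ n)].
have [F FT Ft|M [TM Mmax]] := @Zorn_bigcup R T.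
  have [[I0 [FI0 I0n]]|nF] := pselect (exists I, F I /\ I !=set0); last first.
    left; rewrite -subset0 => x [I FI Ix]; apply: nF; exists I; split=> //.
    by exists x.
  have TF I x : F I -> I x -> [/\ ideal I, P `<=` I & forall n, ~ I (g ^+ n)].
    by move=> /FT[->|].
  have [x0 I0x0] := I0n; have [iI0 PI0 _] := TF _ _ FI0 I0x0.
  right; split=> [|x Px|n [I FI In]]; last 2 first.
  - by exists I0 => //; exact: PI0.
  - by have [_ _ /(_ n)] := TF _ _ FI In.
  split; first by exists I0 => //; case: iI0.
    move=> x y [I FI Ix] [J FJ Jy].
    have [[_ ID _] _ _] := TF _ _ FI Ix; have [[_ JD _] _ _] := TF _ _ FJ Jy.
    have [IJ|JI] := Ft _ _ FI FJ.
      by exists J => //; apply: JD => //; exact: IJ.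
    by exists I => //; apply: ID => //; exact: JI.
  move=> a x [I FI Ix]; have [[_ _ IM] _ _] := TF _ _ FI Ix.
  by exists I => //; exact: IM.
have TP : T P by right; split=> [||n]; [case: pP|by []|exact: prime_exp].
have [iM PM Mg] : [/\ ideal M, P `<=` M & forall n, ~ M (g ^+ n)].
  case: TM => // M0; case: (Mmax P) => //; rewrite M0; split=> // P0.
  by have [[/P0]] := pP.
have adj a : ~ M a -> exists n, ideal_adjoin M a (g ^+ n).
  move=> nMa; apply: contrapT => /forallNP nMag.
  apply: (Mmax (ideal_adjoin M a)).
    split; last by move=> sM; apply/nMa/sM/ideal_adjoin_mem.
    exact: ideal_adjoin_sub.
  right; split=> //; first exact: ideal_adjoin_ideal.
  exact: subset_trans (@ideal_adjoin_sub M a).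
have [M0 MD MM] := iM.
exists M; split=> //; last exact: (Mg 1).
split=> // [|a b Mab]; first exact: (Mg 0).
apply: contrapT => /not_orP[/adj[i [r [m [Mm ea]]]] /adj[j [s [n [Mn eb]]]]].
apply: (Mg (i + j)%N); rewrite exprD ea eb.
have -> : (r * a + m) * (s * b + n) =
    r * s * (a * b) + (r * a + m) * n + s * b * m.
  by ring.
by apply: (MD); [apply: (MD)|]; exact: MM.
Qed.

End Ideals.

Section Nullstellensatz.
Variables (k : fieldType) (R : comAlgType k).
Hypothesis R_affine : affine R.
Implicit Types (M P : set R) (a g x : R).

Lemma kernel_adjoin (L : fieldType) (psi : {rmorphism R -> L}) M a z :
  (forall x, psi x = 0 <-> M x) -> ideal_adjoin M a z ->
  exists b, psi a * psi b = psi z.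
Proof.
move=> kerM [r [m [/kerM m0 e]]]; exists r.
by rewrite e rmorphD m0 addr0 rmorphM mulrC.
Qed.

(** The image of [psi] is a field, hence a G-domain with [f = 1]. *)
Lemma maximal_residue_algebraic (L : fieldType) (psi : {rmorphism R -> L}) M a :
  maximal_ideal M -> (forall x, psi x = 0 <-> M x) ->
  algebraicOver (scalar_embedding psi) (psi a).
Proof.
move=> mM kerM; apply: zariski_algebraic => //.
exists 1; first by rewrite rmorph1 oner_neq0.
move=> b /eqP/kerM/(maximal_adjoin1 mM).
by case/(kernel_adjoin kerM) => c e; exists c, 0%N; rewrite e rmorph1.
Qed.

(** For [M] maximal away from the powers of [g], the domain [R / M] is a G-domain, hence algebraic
    over [k], hence a field. *)
Lemma nullstellensatz P g : prime_ideal P -> ~ P g ->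
  exists M, [/\ maximal_ideal M, P `<=` M & ~ M g].
Proof.
move=> pP nPg; have [M [pM PM nMg adj]] := exists_maximal_avoiding pP nPg.
exists M; split=> //; have [L [psi kerM]] := prime_ideal_kernel pM.
have psiG : g_domain psi.
  exists g; first by apply/eqP => /kerM.
  move=> a /eqP/kerM/adj[n /(kernel_adjoin kerM)[b e]].
  by exists b, n; rewrite e rmorphXn.
have [iM M1 _] := pM; split=> // I iI MI nI1; apply/seteqP; split=> // a Ia.
apply: contrapT => nMa; apply: nI1.
have a0 : psi a != 0 by apply/eqP => /kerM.
have : integralOver psi (psi 1 / psi a).
  rewrite rmorph1 div1r.
  have /algebraic_inv/integral_algebraic[p p_mon pa] :=
    zariski_algebraic R_affine psiG a.
  exists (map_poly (in_alg R) p); first exact: monic_map.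
  by rewrite -map_poly_comp.
case/(integral_div_range a0) => d [e]; rewrite rmorph1 expr1n -rmorphM => ae.
have [_ ID IM] := iI.
have -> : 1 = e * a + (1 - a * e) by ring.
apply: ID; first exact: IM.
by apply/MI/kerM; rewrite rmorphB rmorph1 -ae subrr.
Qed.

End Nullstellensatz.

(** * Torus cores of primes *)

Section TorusCurve.
Variables (k : fieldType) (R : comAlgType k) (r : nat) (l : 'I_r -> {poly k}).
Local Notation U := (\prod_i l i).
Implicit Types (phi : torus k r -> R) (t : k) (h : torus k r).

(* Along the curve [t |-> (l i).[t]], [phi] is a rational function of [t] whose
   denominator is a power of [U]. *)
Definition rational_on_curve phi : Prop :=
  exists N (A : {poly R}), forall t h, (forall i, val h i = (l i).[t]) ->
    (U.[t] ^+ N) *: phi h = A.[t%:A].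

Lemma horner_map_in_alg (p : {poly k}) t :
  (map_poly (in_alg R) p).[t%:A] = p.[t]%:A.
Proof. exact: (horner_map (in_alg R)). Qed.

Lemma rational_on_curve_ext phi psi : phi =1 psi ->
  rational_on_curve phi -> rational_on_curve psi.
Proof. by move=> /funext ->. Qed.

Lemma rational_on_curve_const x : rational_on_curve (fun=> x).
Proof. by exists 0, x%:P => t h _; rewrite expr0 scale1r hornerC. Qed.

Lemma rational_on_curveD phi psi : rational_on_curve phi ->
  rational_on_curve psi -> rational_on_curve (fun h => phi h + psi h).
Proof.
move=> [N [A AE]] [M [B BE]]; pose V := map_poly (in_alg R) U.
exists (N + M)%N, (V ^+ M * A + V ^+ N * B) => t h lh.
rewrite hornerD !hornerM !horner_exp horner_map_in_alg -(AE t h lh) -(BE t h lh).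
rewrite -!(rmorphXn (in_alg R)) /= !mulr_algl !scalerA scalerDr -!exprD.
by rewrite [(M + N)%N]addnC.
Qed.

Lemma rational_on_curveM phi psi : rational_on_curve phi ->
  rational_on_curve psi -> rational_on_curve (fun h => phi h * psi h).
Proof.
move=> [N [A AE]] [M [B BE]].
exists (N + M)%N, (A * B) => t h lh.
by rewrite hornerM -(AE t h lh) -(BE t h lh) -scalerAl -scalerAr scalerA exprD.
Qed.

Lemma rational_on_curve_sum (I : Type) (s : seq I) (F : I -> torus k r -> R) :
  (forall i, rational_on_curve (F i)) ->
  rational_on_curve (fun h => \sum_(i <- s) F i h).
Proof.
move=> FE; elim: s => [|i s IH].
  apply: rational_on_curve_ext (rational_on_curve_const 0) => h.
  by rewrite big_nil.
apply: rational_on_curve_ext (rational_on_curveD (FE i) IH) => h.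
by rewrite big_cons.
Qed.

Lemma rational_on_curve_prod (I : Type) (s : seq I) (F : I -> torus k r -> R) :
  (forall i, rational_on_curve (F i)) ->
  rational_on_curve (fun h => \prod_(i <- s) F i h).
Proof.
move=> FE; elim: s => [|i s IH].
  apply: rational_on_curve_ext (rational_on_curve_const 1) => h.
  by rewrite big_nil.
apply: rational_on_curve_ext (rational_on_curveM (FE i) IH) => h.
by rewrite big_cons.
Qed.

Lemma rational_on_curve_coord i (m : int) :
  rational_on_curve (fun h => (val h i ^ m)%:A).
Proof.
case: m => n.
  exists 0, (map_poly (in_alg R) (l i ^+ n)) => t h lh.
  by rewrite horner_map_in_alg horner_exp expr0 scale1r lh.
(* [Negz n] is [-(n + 1)]: the factor [U ^+ n.+1] cancels this negative power of [l i] and leaves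
   the other factors. *)
exists n.+1, (map_poly (in_alg R) ((\prod_(j | j != i) l j) ^+ n.+1)) => t h lh.
rewrite horner_map_in_alg horner_exp scalerA (bigD1 i) //= hornerM exprMn -lh.
by rewrite NegzE -exprnN mulrAC divff ?mul1r // expf_neq0 // torus_neq0.
Qed.

Lemma rational_on_curve_character f : rational_character f ->
  rational_on_curve (fun h => (f h)%:A).
Proof.
move=> [_ _ [s fE]].
apply: (@rational_on_curve_ext (fun h =>
  \sum_(t <- s) t.1%:A * \prod_i (val h i ^ t.2 i)%:A)).
  move=> h; rewrite fE -[RHS]/(in_alg R _) rmorph_sum; apply: eq_bigr => t _.
  by rewrite rmorphM rmorph_prod.
apply: rational_on_curve_sum => t.
apply: rational_on_curveM; first exact: rational_on_curve_const.
by apply: rational_on_curve_prod => i; exact: rational_on_curve_coord.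
Qed.

Lemma rational_on_curve_act (act : torus k r -> {lrmorphism R -> R}) x :
  rational_on setT act -> rational_on_curve (fun h => act h x).
Proof.
move=> [[_ spanE _] rat]; have [n [e [w [we ->]]]] := spanE x Logic.I.
apply: (@rational_on_curve_ext (fun h => \sum_j (e j h)%:A * w j)).
  move=> h; rewrite linear_sum /=; apply: eq_bigr => j _.
  by rewrite (we j).2 mulr_algl.
(* Zero components are treated apart, since rationality of the eigenvalue is known for nonzero
   eigenvectors only. *)
apply: rational_on_curve_sum => j; have [->|wj] := eqVneq (w j) 0.
  by apply: rational_on_curve_ext (rational_on_curve_const 0) => h; rewrite mulr0.
apply: rational_on_curveM (rational_on_curve_const _).
exact/rational_on_curve_character/(rat _ _ wj).
Qed.

End TorusCurve.

Section TorusCore.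
Variables (k : fieldType) (k0 : [pchar k] =i pred0) (R : comAlgType k) (r : nat).
Variable act : torus k r -> {lrmorphism R -> R}.
Hypothesis act_rat : rational_on setT act.
Implicit Type Q : set R.

Definition torus_core Q : set R := [set x | forall h, Q (act h x)].

Lemma natr_inj : injective (fun n => n%:R : k).
Proof.
have natr0 := (pcharf0P k).1 k0.
suff le_inj m n : (m <= n)%N -> m%:R = n%:R :> k -> m = n.
  by move=> m n mn; case/orP: (leq_total m n) => /le_inj ->.
move=> lmn mn; have /eqP : (n - m)%:R == 0 :> k by rewrite natrB // mn subrr.
by move/eqP; rewrite natr0 => ?; apply/eqP; rewrite eqn_leq lmn.
Qed.

(** The images of the natural numbers are distinct in characteristic zero, which gives more roots
    than the degree allows. *)
Lemma poly_vanishing_eq0 (L : fieldType) (sigma : {rmorphism k -> L})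
    (p : {poly L}) :
  (forall t, p.[sigma t] = 0) -> p = 0.
Proof.
move=> p0; apply/eqP; apply: contraT => /max_poly_roots.
move=> /(_ [seq sigma i%:R | i <- iota 0 (size p)]).
rewrite size_map size_iota ltnn => -> //.
  by apply/allP => _ /mapP[i _ ->]; exact/rootP/p0.
rewrite map_inj_uniq ?iota_uniq // => i j /fmorph_inj; exact: natr_inj.
Qed.

(* If [act h0 a] and [act h1 b] are nonzero modulo [Q], then so are the values of
   [act h a] and [act h b] for almost every [h] on the line through [h0] and
   [h1]. *)
Lemma torus_core_prime Q : prime_ideal Q -> prime_ideal (torus_core Q).
Proof.
move=> pQ; have [[Q0 QD QM] Q1 Qp] := pQ; split; first split.
- by move=> h; rewrite rmorph0.
- by move=> x y xQ yQ h; rewrite rmorphD; apply: QD; [exact: xQ|exact: yQ].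
- by move=> a x xQ h; rewrite rmorphM; exact/QM/xQ.
- by move/(_ 1%g); rewrite rmorph1.
move=> a b abQ; apply: contrapT => /not_orP[/existsNP[h0 aQ] /existsNP[h1 bQ]].
have [L [psi kerQ]] := prime_ideal_kernel pQ.
pose l i : {poly k} := (val h0 i)%:P + (val h1 i - val h0 i)%:P * 'X.
have l0 i : val h0 i = (l i).[0].
  by rewrite hornerD hornerM !hornerC hornerX mulr0 addr0.
have l1 i : val h1 i = (l i).[1].
  by rewrite hornerD hornerM !hornerC hornerX mulr1 addrC subrK.
have [N [A AE]] := rational_on_curve_act l a act_rat.
have [M [B BE]] := rational_on_curve_act l b act_rat.
pose U := \prod_i l i; pose sigma := scalar_embedding psi.
have U0 t : U.[t] = 0 \/ exists h : torus k r, forall i, val h i = (l i).[t].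
  have [/forallP lt|] := boolP [forall i, (l i).[t] != 0].
    by right; exists (torus_of lt) => i; rewrite torus_ofE.
  rewrite negb_forall => /existsP[i /negPn/eqP lt].
  by left; rewrite /U (bigD1 i) //= hornerM lt mul0r.
have Uh t (h : torus k r) : (forall i, val h i = (l i).[t]) -> U.[t] != 0.
  move=> lh; rewrite horner_prod; apply/prodf_neq0 => i _.
  by rewrite -lh torus_neq0.
have nz (C : {poly R}) t (h : torus k r) n x :
    (forall i, val h i = (l i).[t]) ->
    (U.[t] ^+ n) *: act h x = C.[t%:A] -> ~ Q (act h x) -> map_poly psi C != 0.
  move=> lh CE xQ; apply: contra_notN xQ => /eqP C0; apply/kerQ.
  have := horner_map psi C t%:A; rewrite C0 horner0 -CE -mulr_algl rmorphM.
  move=> /esym/eqP.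
  rewrite mulf_eq0 -[psi _%:A]/(sigma (U.[t] ^+ n)) fmorph_eq0 expf_eq0.
  by rewrite (negPf (Uh t h lh)) andbF => /eqP.
(* The factor [U] takes care of the parameters at which the line leaves the torus, so the product
   vanishes at every [t]. *)
suff : map_poly sigma U * map_poly psi A * map_poly psi B = 0.
  move/eqP; rewrite !mulf_eq0 (negPf (nz _ _ _ _ _ l0 (AE _ _ l0) aQ)).
  rewrite (negPf (nz _ _ _ _ _ l1 (BE _ _ l1) bQ)) !orbF map_poly_eq0.
  by move/eqP => U_0; have := Uh _ _ l0; rewrite U_0 horner0 eqxx.
apply: (@poly_vanishing_eq0 _ sigma) => t.
rewrite !hornerM horner_map; case: (U0 t) => [->|[h lh]].
  by rewrite rmorph0 !mul0r.
have ev C : (map_poly psi C).[sigma t] = psi C.[t%:A] := horner_map psi C t%:A.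
rewrite -mulrA !ev -rmorphM -(AE t h lh) -(BE t h lh).
apply/eqP; rewrite mulf_eq0; apply/orP; right; apply/eqP/kerQ.
rewrite -scalerAl -scalerAr -rmorphM -mulr_algl; apply: (QM).
by rewrite -mulr_algl; exact/QM/abQ.
Qed.

End TorusCore.

(** * Differential constants modulo a primitive ideal *)

Section Homogenization.
Variables (k : fieldType) (R : comAlgType k).

(** This is [p(a / s)] multiplied by [s] to the degree of [p]. Being an element of [R], it can be
    read modulo several primes. *)
Definition homogenization (p : {poly k}) (a s : R) : R :=
  \sum_(i < size p) p`_i *: (a ^+ i * s ^+ ((size p).-1 - i)).

Lemma homogenizationE (L : fieldType) (psi : {rmorphism R -> L}) p a s c :
  psi s * c = psi a ->
  psi (homogenization p a s) =
    psi s ^+ (size p).-1 * (map_poly (scalar_embedding psi) p).[c].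
Proof.
move=> sc; rewrite horner_coef size_map_poly rmorph_sum mulr_sumr.
apply: eq_bigr => i _; rewrite coef_map -mulr_algl rmorphM [psi (_ * _)]rmorphM.
rewrite !rmorphXn -sc exprMn.
have -> : psi s ^+ (size p).-1 = psi s ^+ i * psi s ^+ ((size p).-1 - i).
  by rewrite -exprD subnKC //; have := ltn_ord i; lia.
by rewrite /=; ring.
Qed.

End Homogenization.

Section Constants.
Variables (k : fieldType) (R : comAlgType k) (D : set (R -> R)).
Hypotheses (derD : D `<=` derivation) (R_affine : affine R).

Lemma derivation_scalar (d : R -> R) (c : k) : derivation d -> d c%:A = 0.
Proof.
move=> dd; have [dl dM] := dd.
have d1 : d 1 = 0.
  have := dM 1 1; rewrite !(mulr1, mul1r) => /eqP.
  by rewrite -subr_eq subrr eq_sym => /eqP.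
by have := dl c 1 0; rewrite (derivation0 dd) !addr0 d1 scaler0.
Qed.

Lemma derivationB (d : R -> R) : derivation d -> {morph d : x y / x - y}.
Proof. by move=> dd x y; apply/eqP; rewrite eq_sym subr_eq -derivationD // subrK. Qed.

Variables (M : set R) (M_max : maximal_ideal M).
Local Notation P := (delta_core D M).
Variables (L : fieldType) (psi : {rmorphism R -> L}).
Hypothesis kerP : forall x, psi x = 0 <-> P x.

(** The last clause says that the numerator given by the quotient rule for [y / g] vanishes, so
    derivations are applied in [R] only. *)
Definition delta_constant (c : L) : Prop :=
  exists y g, [/\ psi g != 0, psi g * c = psi y &
    forall d, D d -> psi g * psi (d y) = psi y * psi (d g)].

Lemma delta_constant_scalar (a : k) : delta_constant (scalar_embedding psi a).
Proof.
exists a%:A, 1; split; rewrite ?rmorph1 ?oner_neq0 ?mul1r // => d Dd.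
have dd := derD Dd; have := derivation_scalar 1 dd; rewrite scale1r => ->.
by rewrite derivation_scalar // !rmorph0 !mulr0.
Qed.

Lemma delta_constantD c e :
  delta_constant c -> delta_constant e -> delta_constant (c + e).
Proof.
move=> [y [g [g0 gc Dy]]] [z [h [h0 he Dz]]].
exists (y * h + z * g), (g * h); split; first by rewrite rmorphM mulf_neq0.
  by rewrite rmorphD !rmorphM -gc -he; ring.
move=> d Dd; have dd := derD Dd; rewrite derivationD // !dd.2 !(rmorphD, rmorphM).
apply/eqP; rewrite -subr_eq0; apply/eqP.
transitivity (psi h ^+ 2 * (psi g * psi (d y) - psi y * psi (d g)) +
  psi g ^+ 2 * (psi h * psi (d z) - psi z * psi (d h))); first by ring.
by rewrite Dy // Dz // !subrr !mulr0 addr0.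
Qed.

Lemma delta_constantM c e :
  delta_constant c -> delta_constant e -> delta_constant (c * e).
Proof.
move=> [y [g [g0 gc Dy]]] [z [h [h0 he Dz]]].
exists (y * z), (g * h); split; first by rewrite rmorphM mulf_neq0.
  by rewrite !rmorphM -gc -he; ring.
move=> d Dd; have dd := derD Dd; rewrite !dd.2 !(rmorphD, rmorphM).
apply/eqP; rewrite -subr_eq0; apply/eqP.
transitivity (psi h * psi z * (psi g * psi (d y) - psi y * psi (d g)) +
  psi g * psi y * (psi h * psi (d z) - psi z * psi (d h))); first by ring.
by rewrite Dy // Dz // !subrr !mulr0 addr0.
Qed.

Lemma delta_constant_horner (p : {poly k}) c :
  delta_constant c -> delta_constant (map_poly (scalar_embedding psi) p).[c].
Proof.
move=> cc; elim/poly_ind: p => [|p a IH].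
  by rewrite rmorph0 horner0 -(rmorph0 (scalar_embedding psi));
  exact: delta_constant_scalar.
rewrite rmorphD rmorphM /= map_polyX map_polyC hornerD hornerM hornerX hornerC.
apply: delta_constantD; last exact: delta_constant_scalar.
exact: delta_constantM.
Qed.

Let M_ideal : ideal M. Proof. by case: M_max. Qed.
Let P_delta : delta_ideal D P. Proof. exact: delta_core_ideal. Qed.
Let derP d x : D d -> psi x = 0 -> psi (d x) = 0.
Proof.
move=> Dd /kerP Px; apply/kerP; have [_ Pd] := P_delta.
by apply: (Pd d Dd); exists x.
Qed.

(** This is [d] applied to [r c = a] with [d c = 0], carried out on the element [r * y - a * g] of
    [P]. *)
Lemma delta_constant_der c d r a : delta_constant c -> D d ->
  psi r * c = psi a -> psi (d r) * c = psi (d a).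
Proof.
move=> [y [g [g0 gc Dy]]] Dd rc; have dd := derD Dd.
have dyc : psi (d y) = c * psi (d g).
  by apply: (mulfI g0); rewrite Dy // -gc; ring.
have : psi (r * y - a * g) = 0 by rewrite rmorphB !rmorphM -gc -rc; ring.
move/(derP Dd); rewrite derivationB // !dd.2 rmorphB !rmorphD !rmorphM -gc dyc -rc.
by move=> e; apply: (mulfI g0); apply/eqP; rewrite -subr_eq0 -e; apply/eqP; ring.
Qed.

(* The denominators of [c] form a [D]-ideal that is not contained in [P], hence
   not in [M]. *)
Lemma delta_constant_denominator c : delta_constant c ->
  exists s a, ~ M s /\ psi s * c = psi a.
Proof.
move=> cc; pose B : set R := [set r | exists a, psi r * c = psi a].
have iB : delta_ideal D B.
  split; first split.
  - by exists 0; rewrite !rmorph0 mul0r.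
  - move=> r r' [a e] [a' e']; exists (a + a').
    by rewrite !rmorphD mulrDl e e'.
  - by move=> b r [a e]; exists (b * a); rewrite !rmorphM -mulrA e.
  - by move=> d Dd _ [r [a e] <-]; exists (d a); exact: delta_constant_der.
apply: contrapT => nex; have BM : B `<=` M.
  by move=> s [a e]; apply: contrapT => Ms; apply: nex; exists s, a.
have [y [g [/eqP g0 gc _]]] := cc; apply/g0/kerP.
by apply: (delta_core_max iB BM); exists y.
Qed.

(** The numerators [b] of the multiples of [c] form a [D]-ideal [N]. Modulo [P], [b * v] is a
    multiple of [u], so [N] lies in [M] and therefore in [P]; but [u] belongs to [N]. *)
Lemma delta_constant_eq0 c u v : delta_constant c ->
  psi v * c = psi u -> M u -> ~ M v -> c = 0.
Proof.
move=> cc vc Mu nMv; pose N : set R := [set b | exists r, psi r * c = psi b].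
have [_ _ MM] := M_ideal; have [_ _ Mp] := maximal_prime M_max.
have iN : delta_ideal D N.
  split; first split.
  - by exists 0; rewrite !rmorph0 mul0r.
  - move=> b b' [r e] [r' e']; exists (r + r').
    by rewrite !rmorphD mulrDl e e'.
  - by move=> b b' [r e]; exists (b * r); rewrite !rmorphM -mulrA e.
  - by move=> d Dd _ [b [r e] <-]; exists (d r); exact: delta_constant_der.
have NM : N `<=` M.
  move=> b [r e]; suff /Mp[] : M (b * v) by [].
  rewrite -[b * v](subrK (r * u)); have [_ MD _] := M_ideal.
  apply: MD; last exact: MM.
  by apply: (@delta_core_sub _ _ D); apply/kerP; rewrite rmorphB !rmorphM -e -vc; ring.
have /kerP u0 : P u by apply: (delta_core_max iN NM); exists v.
have /eqP : psi v * c = 0 by rewrite vc.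
by rewrite mulf_eq0 => /orP[/eqP/kerP/delta_core_sub|/eqP].
Qed.

(** Write [c = a / s] with [s] outside [M]. A polynomial [p] over [k] that kills the residue of
    [a / s] at [M] makes [p(c)] a constant with numerator in [M], hence zero. *)
Lemma delta_constant_algebraic c : delta_constant c ->
  algebraicOver (scalar_embedding psi) c.
Proof.
move=> cc; have [s [a [nMs sc]]] := delta_constant_denominator cc.
have [L0 [psi0 ker0]] := prime_ideal_kernel (maximal_prime M_max).
have s0 : psi0 s != 0 by apply/eqP => /ker0.
have alg x := maximal_residue_algebraic R_affine x M_max ker0.
have [p p0 /rootP pa] := algebraic_div (alg a) (alg s).
exists p => //; apply/rootP.
apply: (@delta_constant_eq0 _ (homogenization p a s) (s ^+ (size p).-1)).
- exact: delta_constant_horner.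
- by rewrite rmorphXn (homogenizationE p sc).
- apply/ker0; rewrite (@homogenizationE _ _ _ psi0 p a s (psi0 a / psi0 s)).
    by rewrite pa mulr0.
  by rewrite mulrC divfK.
- exact/prime_exp/nMs/maximal_prime.
Qed.

Lemma delta_constant_prime (Q : set R) c y g : prime_ideal Q -> P `<=` Q ->
  delta_constant c -> psi g * c = psi y -> Q y -> ~ Q g -> P y.
Proof.
move=> pQ PQ cc gc Qy nQg; apply: contrapT => nPy.
have c0 : c != 0.
  by apply/eqP => c0; apply/nPy/kerP; rewrite -gc c0 mulr0.
have [p p0] := delta_constant_algebraic cc.
(* Powers of ['X] are split off so that [q] has nonzero constant term; it still kills the nonzero
   [c]. Modulo [Q], its homogenization reduces to that constant times a power of [g]. *)
have [m [q /implyP/(_ p0) q0 ->]] := multiplicity_XsubC p 0.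
rewrite subr0 rmorphM rmorphXn /= map_polyX rootM => /orP[/rootP qc|]; last first.
  by rewrite rootE hornerXn expf_eq0 (negPf c0) andbF.
have [LQ [psiQ kerQ]] := prime_ideal_kernel pQ.
have /PQ/kerQ : P (homogenization q y g).
  by apply/kerP; rewrite (homogenizationE q gc) qc mulr0.
rewrite (@homogenizationE _ _ _ psiQ q y g 0); last by rewrite mulr0; apply/esym/kerQ.
have -> : (map_poly (scalar_embedding psiQ) q).[0] = scalar_embedding psiQ q.[0].
  by rewrite -horner_map rmorph0.
move/eqP; rewrite mulf_eq0 expf_eq0 fmorph_eq0 -rootE (negPf q0) orbF.
by case/andP => _ /eqP/kerQ.
Qed.

End Constants.

(** * Primitive ideals are locally closed *)

Section TorusAction.
Variables (k : fieldType) (k0 : [pchar k] =i pred0) (R : comAlgType k).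
Variables (D : set (R -> R)) (derD : D `<=` derivation).
Variables (r : nat) (act : torus k r -> {lrmorphism R -> R}).
Hypotheses (act_rat : acts_rationally act D) (R_affine : affine R).
Hypothesis fin_HD : finite_set [set P | prime_HD_ideal act D P].

(** [act h (d x)] is the conjugate of [d] by [h] evaluated at [act h x], and [D] is stable under
    conjugation. *)
Lemma torus_core_HD Q : prime_ideal Q -> delta_stable D Q ->
  prime_HD_ideal act D (torus_core act Q).
Proof.
move=> pQ dQ; have [[[act1 actM] rat] [_ _ _ actD] _] := act_rat.
split; first exact: (torus_core_prime k0).
- by move=> h _ [x Qx <-] g; rewrite -[act g _]/((act g \o act h) x) -actM; exact: Qx.
- move=> d Dd _ [x Qx <-] h.
  apply: (dQ (der_act act h d)); first exact: actD.
  exists (act h x); first exact: Qx.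
  rewrite /der_act /= -[act _ (act h x)]/((act h^-1%g \o act h) x) -actM.
  by rewrite mulVg act1.
Qed.

(** [g] is a product of elements outside [P], one from each of the finitely many ideals [J] not
    contained in [P]. *)
Lemma HD_separation P : prime_ideal P ->
  exists2 g, ~ P g & forall J, prime_HD_ideal act D J -> ~ (J `<=` P) -> J g.
Proof.
move=> [_ P1 Pp]; have /finite_seqP[s sE] := fin_HD.
have HDs J : J \in s -> ideal J.
  by move=> Js; have : [set` s] J by []; rewrite -sE => -[[]].
suff [g Pg sg] : exists2 g, ~ P g & forall J, J \in s -> ~ (J `<=` P) -> J g.
  by exists g => // J HJ; apply: sg; have : [set` s] J by rewrite -sE.
elim: s {sE} HDs => [|J s IH] HDs; first by exists 1.
have [|g Pg sg] := IH; first by move=> J' sJ'; apply: HDs; rewrite inE sJ' orbT.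
have [JP|/existsNP[x /not_implyP[Jx Px]]] := pselect (J `<=` P).
  by exists g => // J'; rewrite inE => /orP[/eqP ->|/sg].
exists (g * x); first by case/Pp.
move=> J' sJ' nJ'; have [_ _ JM] := HDs _ sJ'.
move: sJ' nJ' JM; rewrite inE => /orP[/eqP -> _|/sg J'g /J'g {}J'g] JM.
  exact: JM.
by rewrite mulrC; exact: JM.
Qed.

Definition weight_vector (f : torus k r -> k) (x : R) : Prop :=
  forall h, act h x = f h *: x.

(** Characters may repeat and terms may vanish, so dropping one term always leaves a sum of the same
    kind with index one less. *)
Definition weight_sum n (x : R) : Prop :=
  exists (f : 'I_n -> torus k r -> k) (w : 'I_n -> R),
    (forall i, weight_vector (f i) (w i)) /\ x = \sum_i w i.

Lemma weight_sum_exists x : exists n, weight_sum n x.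
Proof.
have [[_ [[_ spanE _] _]] _ _] := act_rat.
have [n [e [w [we ->]]]] := spanE x Logic.I.
by exists n, e, w; split=> // i; have [] := we i.
Qed.

Lemma weight_vectorM f g x y : weight_vector f x -> weight_vector g y ->
  weight_vector (fun h => f h * g h) (x * y).
Proof.
by move=> fx gy h; rewrite rmorphM /= fx gy -scalerAl -scalerAr scalerA.
Qed.

Lemma weight_vector_der d c f x : eigenspace D (der_act act) c d ->
  weight_vector f x -> weight_vector (fun h => c h * f h) (d x).
Proof.
move=> [Dd dc] fx h; have [[[act1 actM] _] _ _] := act_rat.
have := congr1 (fun u => u (act h x)) (dc h); rewrite /der_act /=.
rewrite -[act _ (act h x)]/((act h^-1%g \o act h) x) -actM mulVg act1 => ->.
have [dl _] := derD Dd; rewrite -[LHS]/(c h *: d (act h x)) fx.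
have -> : d (f h *: x) = f h *: d x.
  by have := dl (f h) x 0; rewrite (derivation0 (derD Dd)) !addr0.
by rewrite -scalerA.
Qed.

Lemma eigen_derivations_suffice (T : zmodType) (F : (R -> R) -> T) :
  (forall d e, F (d + e) = F d + F e) ->
  (forall c d, eigenspace D (der_act act) c d -> F d = 0) ->
  forall d, D d -> F d = 0.
Proof.
move=> FD F0 d; have [_ _ [[_ spanE _] _]] := act_rat.
move=> /spanE[n [e [w [we ->]]]].
have Fz : F 0 = 0 by apply: (@addrI _ (F 0)); rewrite -FD !addr0.
elim/big_ind: _ => [//|d1 d2 e1 e2|i _]; first by rewrite FD e1 e2 addr0.
exact: F0 (we i).
Qed.

Lemma delta_primitive_locally_closed M0 : maximal_ideal M0 ->
  exists2 g, ~ delta_core D M0 g & forall M, maximal_ideal M ->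
    delta_core D M0 `<=` M -> ~ M g -> delta_core D M = delta_core D M0.
Proof.
move=> mM0; set P := delta_core D M0.
have pP : prime_ideal P by apply: delta_core_prime => //; exact: maximal_prime.
have dP : delta_ideal D P by apply: delta_core_ideal => //; case: mM0.
have [g nPg HDg] := HD_separation pP; exists g => // M mM PM nMg.
set Q := delta_core D M.
have pQ : prime_ideal Q by apply: delta_core_prime => //; exact: maximal_prime.
have [iQ dQ] : delta_ideal D Q by apply: delta_core_ideal => //; case: mM.
have PQ : P `<=` Q by exact: delta_core_max.
apply/seteqP; split=> // x0 Qx0; apply: contrapT => nPx0.
have exn : exists n, `[< exists x, [/\ Q x, ~ P x & weight_sum n x] >].
  by have [n xn] := weight_sum_exists x0; exists n; apply/asboolP; exists x0.
case: (ex_minnP exn) => -[|n] /asboolP[x [Qx nPx [f [w [fw xE]]]]] nmin.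
  by apply: nPx; rewrite xE big_ord0; have [[]] := pP.
have short y : Q y -> weight_sum n y -> P y.
  move=> Qy yn; apply: contrapT => nPy.
  have /nmin : `[< exists x, [/\ Q x, ~ P x & weight_sum n x] >].
    by apply/asboolP; exists y.
  by rewrite ltnn.
have [Q0 QD QM] := iQ.
set y := w ord0.
have xy : x - y = \sum_i w (lift ord0 i) by rewrite xE big_ord_recl addrC addKr.
(* If the eigenvector [y] were in [Q], it would lie in the torus core of [Q], which avoids [g] and
   so is contained in [P]. By minimality the shorter sum [x - y] would be in [P] too, and so would
   [x]. *)
have nQy : ~ Q y.
  move=> Qy; have cy : torus_core act Q y.
    by move=> h; rewrite fw -mulr_algl; exact: QM.
  have HDQ := torus_core_HD pQ dQ.
  have act1 : act 1%g =1 id by case: act_rat => -[[]].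
  have JP : torus_core act Q `<=` P.
    apply: contrapT => /(HDg _ HDQ)/(_ 1%g); rewrite act1 => Qg.
    exact/nMg/(delta_core_sub Qg).
  apply: nPx; have [_ PD _] := dP.1; rewrite -(subrK y x); apply: PD; last exact: JP.
  apply: short; first exact: idealB.
  by exists (f \o lift ord0), (w \o lift ord0); split=> // i; exact: fw.
have [L [psi kerP]] := prime_ideal_kernel pP.
have y0 : psi y != 0 by apply/eqP => /kerP/PQ.
have cc : delta_constant D psi (psi x / psi y).
  exists x, y; split=> //; first by rewrite mulrC divfK.
  move=> d Dd; apply/eqP; rewrite -!rmorphM -subr_eq0 -rmorphB; apply/eqP.
  move: d Dd; apply: (@eigen_derivations_suffice _ (fun d => psi (y * d x - x * d y))).
    move=> d e; rewrite -rmorphD; apply: (congr1 psi).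
    by rewrite -[(d + e) x]/(d x + e x) -[(d + e) y]/(d y + e y); ring.
  move=> c d cd; apply/kerP; have [Dd _] := cd; have dd := derD Dd.
  have Qd z : Q z -> Q (d z) by move=> Qz; apply: (dQ d Dd); exists z.
  (* The contributions of [y] itself cancel; each of the [n] remaining summands [w i] gives one
     eigenvector, of weight [f ord0 * c * f i]. *)
  have -> : y * d x - x * d y = y * d (x - y) - (x - y) * d y.
    by rewrite derivationB //; ring.
  apply: short.
    have -> : y * d (x - y) - (x - y) * d y = y * d x - d y * x.
      by rewrite derivationB //; ring.
    by apply: idealB => //; apply: QM => //; exact: Qd.
  exists (fun i h => f ord0 h * (c h * f (lift ord0 i) h)).
  exists (fun i => y * d (w (lift ord0 i)) - w (lift ord0 i) * d y).
  split=> [i h|].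
    have wyd := weight_vectorM (fw ord0) (weight_vector_der cd (fw (lift ord0 i))) h.
    have dyw := weight_vectorM (fw (lift ord0 i)) (weight_vector_der cd (fw ord0)) h.
    rewrite rmorphB /= wyd dyw scalerBr; congr (_ - _ *: _); ring.
  rewrite xy sumrB -mulr_suml -mulr_sumr; congr (_ * _ - _).
  elim/big_ind2: _ => [|a a' b b' <- <-|//]; first exact: derivation0.
  exact: derivationD.
apply: nPx; apply: (delta_constant_prime derD R_affine mM0 kerP pQ PQ cc _ Qx nQy).
by rewrite mulrC divfK.
Qed.

(** The Nullstellensatz is applied to [g * z]: avoiding [g] forces the core to be that of [M0]. *)
Lemma delta_primitive_dense M0 z : maximal_ideal M0 -> ~ delta_core D M0 z ->
  exists M, [/\ maximal_ideal M, delta_core D M = delta_core D M0 & ~ M z].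
Proof.
move=> mM0 nPz; have [g nPg gP] := delta_primitive_locally_closed mM0.
have pP : prime_ideal (delta_core D M0).
  by apply: delta_core_prime => //; exact: maximal_prime.
have nPgz : ~ delta_core D M0 (g * z) by have [_ _ Pp] := pP; case/Pp.
have [M [mM PM nMgz]] := nullstellensatz R_affine pP nPgz.
have [[_ _ MM] _ _] := mM; exists M; split=> //; last by move/(MM g).
by apply: gP => // Mg; apply: nMgz; rewrite mulrC; exact: MM.
Qed.

End TorusAction.

(** * The quotient topology *)

Lemma delta_ideal_smallest (k : fieldType) (R : comAlgType k)
    (D : set (R -> R)) (I : set R) : delta_ideal D (smallest (delta_ideal D) I).
Proof.
split; first split.
- by move=> J [[[]]].
- move=> x y Ix Iy J J_I; have [[[_ JD _] _] _] := J_I.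
  by apply: JD; [exact: Ix|exact: Iy].
- move=> a x Ix J J_I; have [[[_ _ JM] _] _] := J_I.
  by apply: JM; exact: Ix.
- move=> d Dd _ [x Ix <-] J J_I; have [[_ Jd] _] := J_I.
  by apply: (Jd d Dd); exists x => //; exact: Ix.
Qed.

Theorem corollary3p4 (k : fieldType) (k0 : [pchar k] =i pred0)
    (R : comAlgType k) (D : set (R -> R)) (derD : D `<=` derivation)
    (r : nat) (act : torus k r -> {lrmorphism R -> R})
    (act_rat : acts_rationally act D)
    (R_affine : affine R)
    (fin_HD : finite_set [set P | prime_HD_ideal act D P]) :
  [/\ continuous (pi_m k0 derD),
      range (pi_m k0 derD) = [set: delta_prim k0 derD] &
      topological_quotient (pi_m k0 derD)].
Proof.
(* The preimage of the closed set of [I] is thus the closed set of the [D]-ideal generated by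
   [I]. *)
have pre (I : set R) (Q : set R) : ideal Q ->
    I `<=` delta_core D Q <-> smallest (delta_ideal D) I `<=` Q.
  move=> iQ; split=> [IQ x|sQ x Ix].
    move=> Ix; apply: (@delta_core_sub _ _ D); apply: (Ix); split=> //.
    exact: delta_core_ideal.
  apply: (delta_core_max (@delta_ideal_smallest k R D I) sQ).
  by move=> J [_]; apply.
have closed_pre W : closed W -> closed (pi_m k0 derD @^-1` W).
  move=> /zariski_closedP[I iI ->]; apply/zariski_closedP.
  exists (smallest (delta_ideal D) I).
    by have [] := @delta_ideal_smallest k R D I.
  by apply/seteqP; split=> -[Q mQ] /=; have [iQ _ _] := mQ; move/(pre I Q iQ).
have surj : range (pi_m k0 derD) = setT.
  rewrite -subTset => -[P [Q mQ PQ]] _; exists (exist _ Q mQ) => //.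
  by subst P; congr exist; exact: Prop_irrelevance.
split=> //; first exact/continuous_closedP.
split=> // W; split; first exact: closed_pre.
move=> /zariski_closedP[I iI WI]; apply/zariski_closedP; exists I => //.
have inW M (mM : maximal_ideal M) :
    W (pi_m k0 derD (exist _ M mM)) <-> I `<=` M.
  by have := congr1 (fun S : set (max_spec R) => S (exist _ M mM)) WI;
    rewrite /= => ->.
have piE M M' (mM : maximal_ideal M) (mM' : maximal_ideal M') :
    delta_core D M = delta_core D M' ->
    pi_m k0 derD (exist _ M mM) = pi_m k0 derD (exist _ M' mM').
  by move=> e; exact: eq_exist.
apply/seteqP; split=> p; have [[M mM] _ <-] : range (pi_m k0 derD) p by rewrite surj.
  (* If [x] in [I] were outside the core of [M], density would give [M'] in the same fibre avoiding
     [x]; but [M'] is in the preimage of [W], so it contains [I]. *)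
  move=> Wp x Ix; apply: contrapT => /= nPx.
  have [M' [mM' e nM'x]] :=
    delta_primitive_dense k0 derD act_rat R_affine fin_HD mM nPx.
  apply: nM'x; have /inW : W (pi_m k0 derD (exist _ M' mM')).
    by rewrite (piE _ _ _ mM e).
  exact.
by move=> /= IP; apply/inW; apply: subset_trans IP _; exact: delta_core_sub.
Qed.
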